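(* Let $w=w_1w_2w_3\cdots$ be a Sturmian word over the alphabet $\{a,b\}$, and let $\beta_w=\lim_{n\to\infty}\frac{|\{1\le j\le n: w_j=b\}|}{n}$ (this limit exists for every Sturmian word). Then for every $\delta>0$, \[ M_w(x)=\frac{\beta_w\log 2}{2}\,x+O_\delta\!\left(x^{1/3+\delta}\right)\qquad (x\ge 1), \] where the implied constant depends only on $\delta$ (and $w$).
   Context: A Sturmian word is an infinite word $w=w_1w_2\cdots$ with letters $w_j\in\{a,b\}$ whose complexity function $p_w(n)$, the number of distinct subwords (factors) of length $n$ of $w$, satisfies $p_w(n)=n+1$ for all $n\ge1$. For $n\ge1$ define $o_w(n)=|\{j\in\mathbb{N}: j\mid n,\ w_j=b,\ n/j \text{ odd}\}|$ and $e_w(n)=|\{j\in\mathbb{N}: j\mid n,\ w_j=b,\ n/j\text{ even}\}|$, and $D_w(n)=o_w(n)-e_w(n)$. The mollified average is $M_w(x)=\sum_{n\le x}\left(1-\frac{n}{x}\right)D_w(n)$ (the paper prints the weight as $1-x/n$, but its Perron-formula representation $M_w(x)=\frac{1}{2\pi i}\int_{c-i\infty}^{c+i\infty}\frac{(1-2^{1-s})\zeta(s)F(s)x^s}{s(s+1)}ds$, $c>1$, with $F(s)=\sum_{n\ge1}\mathbf{1}[w_n=b]\,n^{-s}$, corresponds to the weight $1-n/x$). *)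

(* Defs.v *)
From Stdlib Require Import Reals Lra Lia ZArith Arith List.
Open Scope R_scope.

(* A word over {a,b} is w : nat -> bool, with w j = true meaning w_j = b.
   Positions are 1-based: only w 1, w 2, ... are used (w 0 is ignored). *)

Definition is_factor (w : nat -> bool) (n : nat) (l : list bool) : Prop :=
  exists i : nat, (1 <= i)%nat /\ l = map w (seq i n).

Definition complexity_is (w : nat -> bool) (n k : nat) : Prop :=
  exists L : list (list bool),
    NoDup L /\ length L = k /\ (forall l, In l L <-> is_factor w n l).

Definition sturmian (w : nat -> bool) : Prop :=
  forall n : nat, (1 <= n)%nat -> complexity_is w n (S n).

Definition count_b (w : nat -> bool) (n : nat) : nat :=
  length (filter w (seq 1 n)).

Definition D_w (w : nat -> bool) (n : nat) : Z :=
  fold_right Z.add 0%Z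
    (map (fun j =>
            if (w j && (Nat.eqb (n mod j) 0))%bool
            then (if Nat.odd (n / j) then 1%Z else (-1)%Z)
            else 0%Z)
         (seq 1 n)).

Definition M_w (w : nat -> bool) (x : R) : R :=
  fold_right Rplus 0
    (map (fun n =>
            if Rle_dec (INR n) x then (1 - INR n / x) * IZR (D_w w n) else 0)
         (seq 1 (Z.to_nat (up x)))).

(* Main.v *)
Require Import Defs.
From Stdlib Require Import Reals Lra Lia ZArith Arith List.
Open Scope R_scope.

(** Write [u_j = 1] if [w_j = b] and [u_j = 0] otherwise. Summing over the
    divisor pairs [n = j k] gives [M_w(x) = sum_j u_j f(j)] with
    [f(t) = sum_k (-1)^(k+1) max(0, 1 - k t / x)]. Put [y = x/t]; then
    [f(t) = P(y) / y], where [P(y) = sum_k (-1)^(k+1) max(0, y - k)] is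
    nondecreasing and 1-Lipschitz, so [f] varies by at most [2/j] on [[j, j+1]].
    Sturmian words are balanced, hence [sum_(j <= n) u_j = beta n + O(1)], and
    summation by parts replaces [u_j] by [beta] at a cost of [O(log x)]. At the
    same cost [sum_j f(j)] is the integral of [f] over [[1, oo)], which is
    [(x/2) sum_(k <= x) (-1)^(k+1) (1 - k/x)^2 / k = (log 2 / 2) x + O(1)].
    The error is thus even [O(log x)]. *)

(** * Right special factors of a Sturmian word *)

Section Words.

Local Open Scope nat_scope.

Variable w : nat -> bool.

Definition same_factor (p q n : nat) : Prop :=
  forall l, l < n -> w (p + l) = w (q + l).

(** A factor is named by one occurrence [p]; its extensions may be read at other occurrences [q] and
    [r], so the property belongs to the word, not to the position. *)
Definition right_special (p n : nat) : Prop :=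
  exists q r, 1 <= q /\ 1 <= r /\ same_factor p q n /\ same_factor p r n /\
    w (q + n) = true /\ w (r + n) = false.

Lemma same_factor_sym p q n : same_factor p q n -> same_factor q p n.
Proof. intros H l Hl; symmetry; auto. Qed.

Lemma same_factor_trans p q r n :
  same_factor p q n -> same_factor q r n -> same_factor p r n.
Proof. intros H1 H2 l Hl; rewrite H1; auto. Qed.

Lemma same_factor_S p q n :
  same_factor p q n -> w (p + n) = w (q + n) -> same_factor (S p) (S q) n.
Proof.
intros H E l Hl.
replace (S p + l) with (p + S l) by lia; replace (S q + l) with (q + S l) by lia.
destruct (Nat.eq_dec (S l) n) as [->|]; [exact E | apply H; lia].
Qed.

Lemma map_seq_eq p q n :
  map w (seq p n) = map w (seq q n) <-> same_factor p q n.
Proof.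
revert p q; induction n as [|n IH]; intros p q; simpl.
- split; [intros _ l Hl; lia | reflexivity].
- split.
  + intros E l Hl; injection E as E1 E2.
    destruct l as [|l]; [now rewrite !Nat.add_0_r|].
    rewrite <- !plus_n_Sm; apply IH in E2; apply (E2 l); lia.
  + intros H; f_equal.
    * specialize (H 0); rewrite !Nat.add_0_r in H; apply H; lia.
    * apply IH; intros l Hl; specialize (H (S l)).
      rewrite <- !plus_n_Sm in H; apply H; lia.
Qed.

Lemma is_factor_intro p n : 1 <= p -> is_factor w n (map w (seq p n)).
Proof. intros Hp; exists p; auto. Qed.

Lemma removelast_factor p n : removelast (map w (seq p (S n))) = map w (seq p n).
Proof.
rewrite seq_S, map_app; simpl; apply removelast_last.
Qed.

Hypothesis Hw : sturmian w.

(* Deleting the extension by [true] of each of two right special words would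
   leave [n] words of length [n+1] that still cover all [n+1] words of length [n]. *)
Lemma right_special_unique p q n :
  right_special p n -> right_special q n -> same_factor p q n.
Proof.
intros Sp Sq.
destruct n as [|n]; [intros l Hl; lia|].
set (N := S n) in *; assert (HN : 1 <= N) by (unfold N; lia); clearbody N.
apply map_seq_eq.
destruct (list_eq_dec Bool.bool_dec (map w (seq p N)) (map w (seq q N)))
  as [|Hne]; [assumption|exfalso].
destruct (Hw N) as (L & HL & HLl & HLi); [lia|].
destruct (Hw (S N)) as (L' & _ & HLl' & HLi'); [lia|].
destruct Sp as (p1 & p2 & Hp1 & Hp2 & Ep1 & Ep2 & Tp & Fp).
destruct Sq as (q1 & q2 & Hq1 & Hq2 & Eq1 & Eq2 & Tq & Fq).
apply map_seq_eq in Ep1, Ep2, Eq1, Eq2.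
set (u := map w (seq p1 (S N))).
set (v := map w (seq q1 (S N))).
assert (Hext : forall r, w (r + N) = false ->
  map w (seq r (S N)) <> u /\ map w (seq r (S N)) <> v).
{ intros r Hr; unfold u, v; rewrite !seq_S, !map_app; simpl.
  split; intros E; apply app_inj_tail in E; destruct E as [_ E]; congruence. }
assert (Huv : v <> u).
{ intros E; apply (f_equal (@removelast bool)) in E.
  unfold u, v in E; rewrite !removelast_factor in E; congruence. }
pose (dec := list_eq_dec Bool.bool_dec).
assert (HK : incl L (map (@removelast bool) (remove dec u (remove dec v L')))).
{ assert (Hin : forall r l, 1 <= r -> map w (seq r N) = l ->
     map w (seq r (S N)) <> u -> map w (seq r (S N)) <> v ->
     In l (map (@removelast bool) (remove dec u (remove dec v L')))).
  { intros r l Hr <- Hu Hv.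
    rewrite <- removelast_factor; apply in_map.
    apply in_in_remove; [exact Hu|]; apply in_in_remove; [exact Hv|].
    apply HLi', is_factor_intro, Hr. }
  intros l Hl; apply HLi in Hl; destruct Hl as (r & Hr & ->).
  destruct (dec (map w (seq r (S N))) u) as [E|Nu].
  { apply (f_equal (@removelast bool)) in E; unfold u in E.
    rewrite !removelast_factor in E.
    apply (Hin p2); auto; try (apply Hext; assumption); congruence. }
  destruct (dec (map w (seq r (S N))) v) as [E|Nv].
  { apply (f_equal (@removelast bool)) in E; unfold v in E.
    rewrite !removelast_factor in E.
    apply (Hin q2); auto; try (apply Hext; assumption); congruence. }
  apply (Hin r); auto. }
apply NoDup_incl_length in HK; [|exact HL].
rewrite length_map in HK.
assert (In v L') by (apply HLi', is_factor_intro; exact Hq1).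
assert (In u (remove dec v L')).
{ apply in_in_remove; [congruence|]; apply HLi', is_factor_intro; exact Hp1. }
pose proof (remove_length_lt dec L' v ltac:(assumption)).
pose proof (remove_length_lt dec (remove dec v L') u ltac:(assumption)).
lia.
Qed.

(** With such a period every factor of length [t] would already occur at one of the positions 1,
    ..., [t - 1], too few for [t + 1] factors. *)
Lemma sturmian_not_eventually_periodic s t :
  1 <= s -> s < t -> ~ (forall k, w (t + k) = w (s + k)).
Proof.
intros Hs Hst Hper.
destruct (Hw t) as (L & HL & HLl & HLi); [lia|].
assert (Hincl : incl L (map (fun p => map w (seq p t)) (seq 1 (t - 1)))).
{ intros l Hl; apply HLi in Hl; destruct Hl as (r & Hr & ->).
  induction r as [r IH] using lt_wf_ind.
  destruct (le_lt_dec t r) as [Hle|Hlt].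
  - replace (map w (seq r t)) with (map w (seq (r - (t - s)) t)).
    + apply IH; lia.
    + apply map_seq_eq; intros l _.
      specialize (Hper (r - t + l)).
      replace (r + l) with (t + (r - t + l)) by lia.
      replace (r - (t - s) + l) with (s + (r - t + l)) by lia; auto.
  - apply in_map_iff; exists r; split; [reflexivity|]; apply in_seq; lia. }
apply NoDup_incl_length in Hincl; [|exact HL].
rewrite length_map, length_seq in Hincl; lia.
Qed.

(** With no right special factor on the way, each factor determines the next letter, so the walk
    from [s] to [t] repeats forever and [w] is eventually periodic. *)
Lemma right_special_between s t n :
  1 <= s -> s < t -> same_factor s t n ->
  ~ (forall p, s <= p < t -> ~ right_special p n).
Proof.
intros Hs Hst E Hns.
assert (Hnext : forall p q, 1 <= p -> 1 <= q -> ~ right_special p n ->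
   same_factor p q n -> w (p + n) = w (q + n)).
{ intros p q Hp Hq Np Epq.
  destruct (w (p + n)) eqn:Wp, (w (q + n)) eqn:Wq; try reflexivity; exfalso; apply Np.
  - exists p, q; repeat split; auto; intros l _; reflexivity.
  - exists q, p; repeat split; auto; intros l _; reflexivity. }
assert (Hall : forall k, ~ right_special (s + k) n /\ same_factor (s + k) (t + k) n).
{ induction k as [k IH] using lt_wf_ind; split.
  - destruct (le_lt_dec (t - s) k) as [Hle|Hlt].
    (* One period back the same factor occurs, and there it is known not to be right special. *)
    + destruct (IH (k - (t - s))) as [N1 E1]; [lia|].
      replace (t + (k - (t - s))) with (s + k) in E1 by lia.
      intros (q & r & Hq & Hr & Eq & Er & Tq & Fr); apply N1.
      exists q, r; repeat split; auto; eapply same_factor_trans; eauto.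
    + apply Hns; lia.
  - destruct k as [|k]; [rewrite !Nat.add_0_r; exact E|].
    destruct (IH k) as [N1 E1]; [lia|].
    rewrite <- !plus_n_Sm; apply same_factor_S; [exact E1|].
    apply Hnext; auto; lia. }
apply (sturmian_not_eventually_periodic (s + n) (t + n)); [lia|lia|].
intros k; destruct (Hall k) as [N1 E1].
symmetry; replace (s + n + k) with (s + k + n) by lia.
replace (t + n + k) with (t + k + n) by lia.
apply Hnext; auto; lia.
Qed.

(** Pigeonhole: among the [n + 2] positions from [i] on, two carry the same one of the [n + 1]
    factors, and a right special factor occurs between them. *)
Lemma right_special_recurrent i n :
  1 <= i -> 1 <= n -> ~ (forall p, i <= p <= i + n -> ~ right_special p n).
Proof.
intros Hi Hn Hns.
destruct (Hw n Hn) as (L & _ & HLl & HLi).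
assert (Hnd : NoDup (map (fun p => map w (seq p n)) (seq i (n + 2)))).
{ apply NoDup_map_NoDup_ForallPairs; [|apply seq_NoDup].
  intros s t Hs Ht E; apply in_seq in Hs, Ht; apply map_seq_eq in E.
  destruct (lt_eq_lt_dec s t) as [[Hlt| ->]|Hlt]; [exfalso|reflexivity|exfalso].
  - apply (right_special_between s t n); auto; [lia|]; intros; apply Hns; lia.
  - apply (right_special_between t s n); auto; [lia|now apply same_factor_sym|].
    intros; apply Hns; lia. }
apply NoDup_incl_length with (l' := L) in Hnd.
- rewrite length_map, length_seq in Hnd; lia.
- intros l Hl; apply in_map_iff in Hl; destruct Hl as (p & <- & Hp).
  apply in_seq in Hp; apply HLi, is_factor_intro; lia.
Qed.

Lemma right_special_suffix p n : right_special p (S n) -> right_special (S p) n.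
Proof.
assert (Hs : forall q, same_factor p q (S n) -> same_factor (S p) (S q) n).
{ intros q H l Hl; 
  replace (S p + l) with (p + S l) by lia; replace (S q + l) with (q + S l) by lia.
  apply H; lia. }
intros (q & r & Hq & Hr & Eq & Er & Tq & Fr).
exists (S q), (S r); repeat split; auto; try lia.
- now replace (S q + n) with (q + S n) by lia.
- now replace (S r + n) with (r + S n) by lia.
Qed.

(** * Balance and the count of the letter b *)

Definition count_from (i n : nat) : nat := length (filter w (seq i n)).

Lemma count_from_add i m n :
  count_from i (m + n) = count_from i m + count_from (i + m) n.
Proof.
unfold count_from; rewrite seq_app, filter_app, length_app; reflexivity.
Qed.

Lemma count_from_1 i : count_from i 1 = Nat.b2n (w i).
Proof. unfold count_from; simpl; destruct (w i); reflexivity. Qed.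

(* In [c v c] with [v] a palindrome, [c] precedes every occurrence of [v]
   starting inside the block. *)
Lemma palindrome_return i m c p :
  w i = c -> w (i + m + 1) = c ->
  (forall k, k < m -> w (i + 1 + k) = w (i + m - k)) ->
  i <= p <= i + m + 1 -> same_factor (S p) (S i) m -> w p = c.
Proof.
intros H0 H1 Hpal Hp E.
destruct (Nat.eq_dec p i) as [->|N0]; [exact H0|].
destruct (Nat.eq_dec p (i + m + 1)) as [->|N1]; [exact H1|].
set (l := m - (p - i)).
assert (Hl : l < m) by lia.
specialize (E l Hl); specialize (Hpal l Hl).
replace (S p + l) with (i + m + 1) in E by lia.
replace (S i + l) with (i + 1 + l) in E by lia.
replace (i + m - l) with p in Hpal by lia.
congruence.
Qed.

(* A shortest violation has the form [b v b], [a v a] with [v] a palindrome. The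
   right special word of length [|v|+1] occurs near both blocks and is an
   extension of [v] by a letter on the left, which must be [b] and [a] at once. *)
Theorem sturmian_balanced n i j :
  1 <= i -> 1 <= j -> count_from i n <= count_from j n + 1.
Proof.
revert i j; induction n as [n IH] using lt_wf_ind; intros i j Hi Hj.
destruct (le_lt_dec (count_from i n) (count_from j n + 1)) as [|Hbad];
  [assumption|exfalso].
(* By minimality a prefix and the complementary suffix each have excess at most 1, while the total
   excess is at least 2; so both excesses equal 1. *)
assert (Hpre : forall k, 0 < k < n -> count_from i k = count_from j k + 1).
{ intros k Hk.
  pose proof (IH k ltac:(lia) i j Hi Hj).
  pose proof (IH (n - k) ltac:(lia) (i + k) (j + k) ltac:(lia) ltac:(lia)).
  pose proof (count_from_add i k (n - k)); pose proof (count_from_add j k (n - k)).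
  replace (k + (n - k)) with n in * by lia; lia. }
assert (Hb : forall b, Nat.b2n b <= 1) by (intros []; simpl; lia).
destruct n as [|[|m]].
{ unfold count_from in Hbad; simpl in Hbad; lia. }
{ rewrite !count_from_1 in Hbad.
  pose proof (Hb (w i)); pose proof (Hb (w j)); lia. }
assert (Hb1 : forall b, Nat.b2n b = 1 -> b = true) by (intros []; simpl; lia).
assert (Hb0 : forall b, Nat.b2n b = 0 -> b = false) by (intros []; simpl; lia).
pose proof (Hpre 1 ltac:(lia)) as H1; rewrite !count_from_1 in H1.
assert (Wi : w i = true) by (apply Hb1; pose proof (Hb (w i)); lia).
assert (Wj : w j = false) by (apply Hb0; pose proof (Hb (w i)); lia).
pose proof (Hpre (m + 1) ltac:(lia)) as H2.
pose proof (count_from_add i (m + 1) 1) as Ai.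
pose proof (count_from_add j (m + 1) 1) as Aj.
rewrite count_from_1 in Ai, Aj.
replace (m + 1 + 1) with (S (S m)) in Ai, Aj by lia.
rewrite Nat.add_assoc in Ai, Aj.
assert (Wi' : w (i + m + 1) = true)
  by (apply Hb1; pose proof (Hb (w (i + m + 1))); lia).
assert (Wj' : w (j + m + 1) = false)
  by (apply Hb0; pose proof (Hb (w (i + m + 1))); lia).
assert (Hmid : same_factor (S i) (S j) m).
{ intros l Hl.
  pose proof (Hpre (l + 1) ltac:(lia)); pose proof (Hpre (l + 1 + 1) ltac:(lia)).
  pose proof (count_from_add i (l + 1) 1) as B1.
  pose proof (count_from_add j (l + 1) 1) as B2.
  rewrite count_from_1 in B1, B2.
  replace (S i + l) with (i + (l + 1)) by lia.
  replace (S j + l) with (j + (l + 1)) by lia.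
  destruct (w (i + (l + 1))), (w (j + (l + 1))); simpl in *; congruence || lia. }
assert (Hcount : forall k s, 1 <= s -> s + k <= m + 1 ->
  count_from (i + s) k = count_from (j + s) k).
{ intros k s Hs Hk.
  pose proof (Hpre s ltac:(lia)); pose proof (Hpre (s + k) ltac:(lia)).
  pose proof (count_from_add i s k); pose proof (count_from_add j s k); lia. }
(* Let [v] be the common middle word. Balance in length [k + 1] compares b·prefix with suffix·a,
   then suffix·b with a·prefix, for the prefix and suffix of [v] of length [k]; hence these have
   equal counts. *)
assert (HPQ : forall k, k <= m ->
  count_from (i + 1) k = count_from (i + (m + 1 - k)) k).
{ intros k Hk.
  pose proof (IH (1 + k) ltac:(lia) i (j + (m + 1 - k)) ltac:(lia) ltac:(lia)) as B1.
  pose proof (IH (k + 1) ltac:(lia) (i + (m + 1 - k)) j ltac:(lia) ltac:(lia)) as B2.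
  rewrite (Nat.add_comm k 1), (count_from_add j) in B2.
  rewrite (Nat.add_comm 1 k), (count_from_add (i + (m + 1 - k))) in B2.
  rewrite (count_from_add i) in B1.
  rewrite (Nat.add_comm 1 k), (count_from_add (j + (m + 1 - k))) in B1.
  rewrite !count_from_1 in B1, B2.
  replace (i + (m + 1 - k) + k) with (i + m + 1) in B2 by lia.
  replace (j + (m + 1 - k) + k) with (j + m + 1) in B1 by lia.
  rewrite Wi, Wj' in B1; rewrite Wi', Wj in B2; simpl Nat.b2n in *.
  pose proof (Hcount k 1 ltac:(lia) ltac:(lia)).
  pose proof (Hcount k (m + 1 - k) ltac:(lia) ltac:(lia)).
  lia. }
assert (Hpal : forall k, k < m -> w (i + 1 + k) = w (i + m - k)).
{ intros k Hk.
  pose proof (HPQ k ltac:(lia)) as B1; pose proof (HPQ (k + 1) ltac:(lia)) as B2.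
  rewrite (count_from_add (i + 1)), count_from_1 in B2.
  rewrite (Nat.add_comm k 1), (count_from_add (i + _)), count_from_1 in B2.
  replace (i + (m + 1 - (1 + k))) with (i + m - k) in B2 by lia.
  replace (i + m - k + 1) with (i + (m + 1 - k)) in B2 by lia.
  destruct (w (i + 1 + k)), (w (i + m - k)); simpl in *; congruence || lia. }
assert (Hpalj : forall k, k < m -> w (j + 1 + k) = w (j + m - k)).
{ intros k Hk.
  pose proof (Hmid k Hk) as E1; pose proof (Hmid (m - 1 - k) ltac:(lia)) as E2.
  replace (S i + k) with (i + 1 + k) in E1 by lia.
  replace (S j + k) with (j + 1 + k) in E1 by lia.
  replace (S i + (m - 1 - k)) with (i + m - k) in E2 by lia.
  replace (S j + (m - 1 - k)) with (j + m - k) in E2 by lia.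
  rewrite <- E1, <- E2; auto. }
assert (Si : right_special (S i) m).
{ exists (S i), (S j); repeat split; auto; try lia; try (intros l _; reflexivity).
  - now replace (S i + m) with (i + m + 1) by lia.
  - now replace (S j + m) with (j + m + 1) by lia. }
(* The windows for [p] and [q] are the ranges allowed by [palindrome_return]. Dropping the first
   letter of either special word leaves [v]; uniqueness in length [m + 1] then equates the two first
   letters. *)
apply (right_special_recurrent i (S m)); [lia|lia|]; intros p Hp Sp.
apply (right_special_recurrent j (S m)); [lia|lia|]; intros q Hq Sq.
pose proof (right_special_unique _ _ _ (right_special_suffix _ _ Sp) Si) as Ep.
pose proof (right_special_unique _ _ _ (right_special_suffix _ _ Sq) Si) as Eq.
assert (Wp : w p = true) by (apply (palindrome_return i m); auto; lia).
assert (Wq : w q = false).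
{ apply (palindrome_return j m); auto; [lia|].
  eapply same_factor_trans; eauto. }
pose proof (right_special_unique _ _ _ Sp Sq 0 ltac:(lia)) as E.
rewrite !Nat.add_0_r in E; congruence.
Qed.

(** The first [q * n] letters split into [q] blocks, each with a count within 1 of that of the first
    block. *)
Lemma count_b_mul q n :
  count_b w (q * n) <= q * count_b w n + q /\ q * count_b w n <= count_b w (q * n) + q.
Proof.
induction q as [|q IH]; [change (count_b w (0 * n)) with 0; lia|].
assert (E : count_b w (S q * n) = count_b w (q * n) + count_from (1 + q * n) n).
{ replace (S q * n) with (q * n + n) by lia; apply (count_from_add 1). }
pose proof (sturmian_balanced n 1 (1 + q * n) ltac:(lia) ltac:(lia)) as H1.
pose proof (sturmian_balanced n (1 + q * n) 1 ltac:(lia) ltac:(lia)) as H2.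
change (count_from 1 n) with (count_b w n) in *.
rewrite E; lia.
Qed.

End Words.

(** Divide the bounds of [count_b_mul] by [q] and let [q] grow: [count_b w (q * n) / q] tends to
    [beta * n]. *)
Lemma sturmian_discrepancy (w : nat -> bool) (beta : R) (n : nat) :
  sturmian w ->
  Un_cv (fun n => INR (count_b w (S n)) / INR (S n)) beta ->
  Rabs (INR (count_b w n) - beta * INR n) <= 1.
Proof.
intros Hw Hb.
destruct n as [|n].
{ unfold count_b; simpl; rewrite Rmult_0_r, Rminus_0_r, Rabs_R0; lra. }
apply le_epsilon; intros eps Heps.
set (c := INR (count_b w (S n))); set (N := INR (S n)).
assert (HN : 0 < N) by (apply lt_0_INR; lia).
(* Accuracy [eps / N] for the frequency at length [Q * N] is an error [Q * eps] in the count, hence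
   [eps] after division by [Q]. *)
destruct (Hb (eps / N)) as [q0 Hq]; [apply Rdiv_lt_0_compat; lra|].
set (m := (S q0 * S n)%nat).
assert (Hm : (S q0 <= m)%nat) by (unfold m; nia).
specialize (Hq (m - 1)%nat ltac:(lia)); unfold Rdist in Hq.
replace (S (m - 1)) with m in Hq by lia.
destruct (count_b_mul w Hw (S q0) (S n)) as [H1 H2].
fold m in H1, H2.
apply le_INR in H1, H2.
rewrite plus_INR, mult_INR in H1, H2; fold c in H1, H2.
set (Q := INR (S q0)) in *.
assert (HQ : 0 < Q) by (apply lt_0_INR; lia).
assert (Em : INR m = Q * N) by (unfold m; apply mult_INR).
set (d := INR (count_b w m)) in *.
rewrite Em in Hq.
assert (Hd : Rabs (d - Q * N * beta) <= Q * eps).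
{ replace (d - Q * N * beta) with ((Q * N) * (d / (Q * N) - beta)) by (field; lra).
  rewrite Rabs_mult, (Rabs_pos_eq (Q * N)) by nra.
  replace (Q * eps) with ((Q * N) * (eps / N)) by (field; lra).
  apply Rmult_le_compat_l; [nra|lra]. }
apply Rmult_le_reg_l with Q; [exact HQ|].
rewrite <- (Rabs_pos_eq Q) at 1 by lra; rewrite <- Rabs_mult.
apply Rabs_le; revert Hd; unfold Rabs; destruct Rcase_abs; intros; split; nra.
Qed.

(** * Finite sums over 1, ..., n *)

Fixpoint sum1 (f : nat -> R) (n : nat) : R :=
  match n with 0%nat => 0 | S m => sum1 f m + f (S m) end.

Lemma fold_right_sum1 f n : fold_right Rplus 0 (map f (seq 1 n)) = sum1 f n.
Proof.
induction n as [|n IH]; [reflexivity|].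
rewrite seq_S, map_app, fold_right_app; simpl; rewrite <- IH.
generalize (map f (seq 1 n)) as l; intros l; rewrite Rplus_0_r.
induction l as [|y l IHl]; simpl; lra.
Qed.

Lemma sum1_ext f g n :
  (forall k, (1 <= k <= n)%nat -> f k = g k) -> sum1 f n = sum1 g n.
Proof.
induction n as [|n IH]; intros H; [reflexivity|]; simpl.
rewrite IH, H; [reflexivity|lia|intros; apply H; lia].
Qed.

Lemma sum1_plus f g n : sum1 (fun k => f k + g k) n = sum1 f n + sum1 g n.
Proof. induction n as [|n IH]; simpl; [|rewrite IH]; ring. Qed.

Lemma sum1_minus f g n : sum1 (fun k => f k - g k) n = sum1 f n - sum1 g n.
Proof. induction n as [|n IH]; simpl; [|rewrite IH]; ring. Qed.

Lemma sum1_scal c f n : sum1 (fun k => c * f k) n = c * sum1 f n.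
Proof. induction n as [|n IH]; simpl; [|rewrite IH]; ring. Qed.

Lemma sum1_zero n : sum1 (fun _ => 0) n = 0.
Proof. induction n as [|n IH]; simpl; [|rewrite IH]; ring. Qed.

Lemma sum1_swap (f : nat -> nat -> R) m n :
  sum1 (fun i => sum1 (f i) n) m = sum1 (fun j => sum1 (fun i => f i j) m) n.
Proof.
induction m as [|m IH]; simpl; [now rewrite sum1_zero|].
now rewrite IH, sum1_plus.
Qed.

Lemma sum1_Rabs_le f g n :
  (forall k, (1 <= k <= n)%nat -> Rabs (f k) <= g k) -> Rabs (sum1 f n) <= sum1 g n.
Proof.
induction n as [|n IH]; intros H; simpl; [rewrite Rabs_R0; lra|].
eapply Rle_trans; [apply Rabs_triang|].
apply Rplus_le_compat; [apply IH; intros; apply H; lia|apply H; lia].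
Qed.

Lemma sum1_truncate f m n :
  (m <= n)%nat -> (forall k, (m < k <= n)%nat -> f k = 0) -> sum1 f n = sum1 f m.
Proof.
intros Hmn; induction Hmn as [|n Hmn IH]; intros H; [reflexivity|]; simpl.
rewrite IH, H; [ring|lia|intros; apply H; lia].
Qed.

Lemma sum1_first f n : sum1 f (S n) = f 1%nat + sum1 (fun k => f (S k)) n.
Proof. induction n as [|n IH]; [simpl; ring|]. simpl in *; rewrite IH; ring. Qed.

Lemma sum1_telescope f n : sum1 (fun k => f (S k) - f k) n = f (S n) - f 1%nat.
Proof. induction n as [|n IH]; simpl; [|rewrite IH]; ring. Qed.

Lemma sum1_multiples (j : nat) (f : nat -> R) n : (1 <= j)%nat ->
  sum1 (fun m => if Nat.eqb (m mod j) 0 then f m else 0) n =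
  sum1 (fun k => f (j * k)%nat) (n / j).
Proof.
intros Hj; induction n as [|n IH].
{ rewrite Nat.div_small by lia; reflexivity. }
change (sum1 ?g (S n)) with (sum1 g n + g (S n)); cbv beta.
rewrite IH.
pose proof (Nat.div_mod_eq n j) as D; pose proof (Nat.mod_upper_bound n j ltac:(lia)) as B.
(* Passing from [n] to [n + 1] meets a new multiple of [j] exactly when [n mod j = j - 1]. *)
destruct (Nat.eq_dec (n mod j) (j - 1)) as [E|E].
- assert (E1 : (S n / j = S (n / j))%nat)
    by (symmetry; apply Nat.div_unique with 0%nat; nia).
  assert (E2 : (S n mod j = 0)%nat)
    by (symmetry; apply Nat.mod_unique with (S (n / j))%nat; nia).
  rewrite E1, E2; simpl; do 2 f_equal; nia.
- assert (E1 : (S n / j = n / j)%nat)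
    by (symmetry; apply Nat.div_unique with (S (n mod j)); nia).
  assert (E2 : (S n mod j = S (n mod j))%nat)
    by (symmetry; apply Nat.mod_unique with (n / j)%nat; nia).
  rewrite E1, E2; simpl; ring.
Qed.

Lemma abel_summation (u f : nat -> R) n :
  sum1 (fun j => u j * f j) n =
  sum1 (fun j => sum1 u j * (f j - f (S j))) n + sum1 u n * f (S n).
Proof. induction n as [|n IH]; simpl; [ring|]; rewrite IH; simpl; ring. Qed.

(** * Alternating sums *)

(** This is [(-1)^(k+1)]; its value -1 at 0 makes the closed forms below true for [n = 0] too. *)
Definition sgn (k : nat) : R := if Nat.odd k then 1 else -1.

Lemma sgn_S k : sgn (S k) = - sgn k.
Proof.
unfold sgn; rewrite Nat.odd_succ, <- Nat.negb_odd; destruct (Nat.odd k); simpl; ring.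
Qed.

(** Leibniz: removing the first term leaves minus a sum of the same kind for the shifted sequence,
    which lies between 0 and [c 2]. *)
Lemma alternating_sum_bounds (c : nat -> R) n :
  (forall k, (1 <= k)%nat -> 0 <= c (S k) <= c k) ->
  0 <= sum1 (fun k => sgn k * c k) n <= c 1%nat.
Proof.
revert c; induction n as [|n IH]; intros c Hc.
- simpl; specialize (Hc 1%nat ltac:(lia)); lra.
- rewrite sum1_first.
  rewrite (sum1_ext _ (fun k => -1 * (sgn k * c (S k)))) by (intros; rewrite sgn_S; ring).
  rewrite sum1_scal.
  specialize (IH (fun k => c (S k)) ltac:(intros; apply Hc; lia)).
  specialize (Hc 1%nat ltac:(lia)); change (sgn 1) with 1; lra.
Qed.

Lemma sum1_sgn n : sum1 sgn n = (1 + sgn n) / 2.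
Proof.
induction n as [|n IH]; cbn [sum1]; [unfold sgn; simpl; field|].
rewrite IH, sgn_S; field.
Qed.

Lemma sum1_sgn_id n : sum1 (fun k => sgn k * INR k) n = (1 + sgn n * (2 * INR n + 1)) / 4.
Proof.
induction n as [|n IH]; cbn [sum1]; [unfold sgn; simpl; field|].
rewrite IH, sgn_S, S_INR; field.
Qed.

(** * Harmonic numbers and the alternating series of log 2 *)

Definition harmonic (n : nat) : R := sum1 (fun k => / INR k) n.

(** Both sides are [ln y <= y - 1], taken at [t / (t + 1)] and at [(t + 1) / t]. *)
Lemma ln_increment_bounds t : 0 < t -> / (t + 1) <= ln (t + 1) - ln t <= / t.
Proof.
intros Ht.
assert (Hln : forall y, 0 < y -> ln y <= y - 1).
{ intros y Hy; pose proof (exp_ineq1_le (ln y)) as H; rewrite exp_ln in H; lra. }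
split.
- replace (ln (t + 1) - ln t) with (- (ln (t / (t + 1)))).
  + pose proof (Hln (t / (t + 1)) ltac:(apply Rdiv_lt_0_compat; lra)) as H.
    replace (t / (t + 1) - 1) with (- / (t + 1)) in H by (field; lra); lra.
  + unfold Rdiv; rewrite ln_mult, ln_Rinv; try apply Rinv_0_lt_compat; lra.
- replace (ln (t + 1) - ln t) with (ln ((t + 1) / t))
    by (unfold Rdiv; rewrite ln_mult, ln_Rinv; try apply Rinv_0_lt_compat; lra).
  pose proof (Hln ((t + 1) / t) ltac:(apply Rdiv_lt_0_compat; lra)) as H.
  replace ((t + 1) / t - 1) with (/ t) in H by (field; lra); lra.
Qed.

Lemma harmonic_sub_le a b : (1 <= a <= b)%nat ->
  harmonic b - harmonic a <= ln (INR b) - ln (INR a).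
Proof.
intros [Ha Hab]; induction Hab as [|b Hab IH]; [lra|].
unfold harmonic in *; cbn [sum1]; rewrite S_INR.
pose proof (ln_increment_bounds (INR b) ltac:(apply lt_0_INR; lia)); lra.
Qed.

Lemma harmonic_sub_ge a b : (a <= b)%nat ->
  ln (INR b + 1) - ln (INR a + 1) <= harmonic b - harmonic a.
Proof.
intros Hab; induction Hab as [|b Hab IH]; [lra|].
unfold harmonic in *; cbn [sum1]; rewrite S_INR.
pose proof (ln_increment_bounds (INR b + 1) ltac:(pose proof (pos_INR b); lra)); lra.
Qed.

Lemma harmonic_le n : (1 <= n)%nat -> harmonic n <= 1 + ln (INR n).
Proof.
intros Hn; pose proof (harmonic_sub_le 1 n ltac:(lia)) as H.
unfold harmonic at 2 in H; simpl in H; rewrite ln_1 in H; lra.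
Qed.

(** Flipping the sign of the even terms subtracts twice their sum, which is [harmonic n]. *)
Lemma alternating_harmonic_even n :
  sum1 (fun k => sgn k * / INR k) (2 * n) = harmonic (2 * n) - harmonic n.
Proof.
induction n as [|n IH]; [unfold harmonic; simpl; ring|].
replace (2 * S n)%nat with (S (S (2 * n))) by lia.
unfold harmonic in *; cbn [sum1]; rewrite IH, !sgn_S.
replace (sgn (2 * n)) with (-1) by (unfold sgn; rewrite Nat.odd_mul; reflexivity).
rewrite !S_INR, mult_INR; change (INR 2) with 2; pose proof (pos_INR n); field; lra.
Qed.

(** For even [n] the difference of harmonic numbers is squeezed between differences of logarithms;
    odd [n] adds one term. The rate 1/n keeps the error bounded after multiplication by [x / 2] with
    [n] near [x]. *)
Lemma alternating_harmonic_ln2 n :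
  Rabs (sum1 (fun k => sgn k * / INR k) n - ln 2) <= 2 / (INR n + 1).
Proof.
assert (Hl2 : 0 <= ln 2 <= 1) by (pose proof (ln_increment_bounds 1); rewrite ln_1 in *;
  replace (1 + 1) with 2 in * by ring; lra).
assert (Heven : forall m, (1 <= m)%nat ->
  ln 2 - / (2 * INR m + 1) <= sum1 (fun k => sgn k * / INR k) (2 * m) <= ln 2).
{ intros m Hm; rewrite alternating_harmonic_even.
  pose proof (lt_0_INR m ltac:(lia)) as Pm.
  pose proof (harmonic_sub_le m (2 * m) ltac:(lia)) as H1.
  pose proof (harmonic_sub_ge m (2 * m) ltac:(lia)) as H2.
  rewrite mult_INR in H1, H2; change (INR 2) with 2 in H1, H2.
  rewrite ln_mult in H1 by lra.
  replace (ln (INR m + 1)) with (ln (2 * INR m + 1 + 1) - ln 2) in H2.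
  - pose proof (ln_increment_bounds (2 * INR m + 1) ltac:(lra)); lra.
  - replace (2 * INR m + 1 + 1) with (2 * (INR m + 1)) by ring.
    rewrite ln_mult by lra; ring. }
destruct (Nat.Even_or_Odd n) as [[m ->]|[m ->]].
- destruct m as [|m].
  { simpl; apply Rabs_le; lra. }
  specialize (Heven (S m) ltac:(lia)).
  rewrite mult_INR; change (INR 2) with 2.
  pose proof (lt_0_INR (S m) ltac:(lia)) as Pm; set (t := INR (S m)) in *.
  assert (0 < / (2 * t + 1)) by (apply Rinv_0_lt_compat; lra).
  unfold Rdiv; apply Rabs_le; lra.
- destruct m as [|m].
  { simpl; change (sgn 1) with 1; rewrite Rinv_1.
    replace (2 / (1 + 1)) with 1 by field; apply Rabs_le; lra. }
  specialize (Heven (S m) ltac:(lia)).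
  replace (2 * S m + 1)%nat with (S (2 * S m)) by lia.
  change (sum1 ?f (S (2 * S m))) with (sum1 f (2 * S m) + f (S (2 * S m))); cbv beta.
  rewrite sgn_S.
  replace (sgn (2 * S m)) with (-1) by (unfold sgn; rewrite Nat.odd_mul; reflexivity).
  rewrite S_INR, mult_INR; change (INR 2) with 2.
  pose proof (lt_0_INR (S m) ltac:(lia)) as Pm; set (t := INR (S m)) in *.
  assert (/ (2 * t + 1) <= 2 / (2 * t + 1 + 1)).
  { unfold Rdiv; apply Rmult_le_reg_l with ((2 * t + 1) * (2 * t + 1 + 1)); [nra|].
    field_simplify; lra. }
  assert (0 < / (2 * t + 1)) by (apply Rinv_0_lt_compat; lra).
  apply Rabs_le; lra.
Qed.

(** * The kernel and its variation *)

Definition pos (r : R) : R := Rmax 0 r.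

Lemma pos_cases r : (0 <= r /\ pos r = r) \/ (r <= 0 /\ pos r = 0).
Proof.
unfold pos; destruct (Rle_dec 0 r).
- left; split; [lra|apply Rmax_right; lra].
- right; split; [lra|apply Rmax_left; lra].
Qed.

Lemma pos_scal c r : 0 <= c -> pos (c * r) = c * pos r.
Proof.
intros Hc; destruct (pos_cases r) as [[? ->]|[? ->]];
destruct (pos_cases (c * r)) as [[? ->]|[? ->]]; nra.
Qed.

(** The function [P] of the overview, cut at [k <= n]; the cut changes nothing when [y <= n + 1]. *)
Definition tent_sum (n : nat) (y : R) : R := sum1 (fun k => sgn k * pos (y - INR k)) n.

(** Since [pos] is convex and nondecreasing, the increments [pos (y - k) - pos (z - k)] are
    nonnegative and do not increase with [k]; so the alternating sum lies between 0 and the first of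
    them, at most [y - z]. *)
Lemma tent_sum_lipschitz n y z : z <= y -> 0 <= tent_sum n y - tent_sum n z <= y - z.
Proof.
intros Hzy; unfold tent_sum; rewrite <- sum1_minus.
rewrite (sum1_ext _ (fun k => sgn k * (pos (y - INR k) - pos (z - INR k))))
  by (intros; ring).
assert (H : 0 <= sum1 (fun k => sgn k * (pos (y - INR k) - pos (z - INR k))) n
  <= pos (y - INR 1) - pos (z - INR 1)).
{ apply (alternating_sum_bounds (fun k => pos (y - INR k) - pos (z - INR k))).
  intros k _; rewrite S_INR.
  destruct (pos_cases (y - INR k)) as [[? ->]|[? ->]],
    (pos_cases (z - INR k)) as [[? ->]|[? ->]],
    (pos_cases (y - (INR k + 1))) as [[? ->]|[? ->]],
    (pos_cases (z - (INR k + 1))) as [[? ->]|[? ->]]; lra. }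
destruct (pos_cases (y - INR 1)) as [[? E1]|[? E1]],
    (pos_cases (z - INR 1)) as [[? E2]|[? E2]]; rewrite E1, E2 in H; lra.
Qed.

Lemma tent_sum_bounds n y : 0 <= y -> 0 <= tent_sum n y <= y.
Proof.
intros Hy; pose proof (tent_sum_lipschitz n y 0 Hy) as H.
replace (tent_sum n 0) with 0 in H; [lra|].
unfold tent_sum; rewrite (sum1_ext _ (fun _ => 0)); [now rewrite sum1_zero|].
intros k Hk; destruct (pos_cases (0 - INR k)) as [[? ->]|[? ->]];
  pose proof (lt_0_INR k ltac:(lia)); lra.
Qed.

(** The function [f(t)] of the overview, cut at [k <= n]; one cut [n >= x] serves all [t >= 1]. *)
Definition kernel (n : nat) (x t : R) : R :=
  sum1 (fun k => sgn k * pos (1 - INR k * t / x)) n.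

Lemma kernel_tent_sum n x t : 0 < x -> 0 < t ->
  kernel n x t = t / x * tent_sum n (x / t).
Proof.
intros Hx Ht; unfold kernel, tent_sum; rewrite <- sum1_scal.
apply sum1_ext; intros k _.
replace (1 - INR k * t / x) with (t / x * (x / t - INR k)) by (field; lra).
rewrite pos_scal; [ring|].
apply Rlt_le, Rdiv_lt_0_compat; lra.
Qed.

Lemma kernel_variation n x s t : 0 < x -> 0 < s -> s <= t <= s + 1 ->
  Rabs (kernel n x s - kernel n x t) <= 2 * / s.
Proof.
intros Hx Hs Hst.
rewrite !kernel_tent_sum by lra.
assert (Hle : x / t <= x / s).
{ unfold Rdiv; apply Rmult_le_compat_l; [lra|]; apply Rinv_le_contravar; lra. }
assert (Hpos : 0 < x / t) by (apply Rdiv_lt_0_compat; lra).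
pose proof (tent_sum_lipschitz n _ _ Hle) as [L1 L2].
pose proof (tent_sum_bounds n (x / t) ltac:(lra)) as [B1 B2].
set (P := tent_sum n (x / s)) in *; set (Q := tent_sum n (x / t)) in *.
(* This separates the change of [P] from the change of the factor [t / x]; each contributes a
   quantity in [0, 1/s]. *)
replace (s / x * P - t / x * Q) with (s / x * (P - Q) - (t - s) / x * Q)
  by (field; lra).
assert (E1 : 0 <= s / x * (P - Q) <= / s).
{ assert (0 < s / x) by (apply Rdiv_lt_0_compat; lra).
  split; [nra|]. apply Rle_trans with (s / x * (x / s - x / t)); [nra|].
  replace (s / x * (x / s - x / t)) with ((t - s) / t) by (field; lra).
  apply Rmult_le_reg_l with (s * t); [nra|].
  replace (s * t * ((t - s) / t)) with (s * (t - s)) by (field; lra).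
  replace (s * t * / s) with t by (field; lra). nra. }
assert (E2 : 0 <= (t - s) / x * Q <= / s).
{ assert (0 <= (t - s) / x) by (apply Rmult_le_pos; [lra|]; apply Rlt_le, Rinv_0_lt_compat; lra).
  split; [nra|]. apply Rle_trans with ((t - s) / x * (x / t)); [nra|].
  replace ((t - s) / x * (x / t)) with ((t - s) / t) by (field; lra).
  apply Rmult_le_reg_l with (s * t); [nra|].
  replace (s * t * ((t - s) / t)) with (s * (t - s)) by (field; lra).
  replace (s * t * / s) with t by (field; lra). nra. }
apply Rabs_le; lra.
Qed.

Lemma kernel_vanish n x t : 0 < x -> x <= t -> kernel n x t = 0.
Proof.
intros Hx Ht; unfold kernel; rewrite (sum1_ext _ (fun _ => 0)); [apply sum1_zero|].
intros k Hk; pose proof (le_INR 1 k ltac:(lia)) as Hk1; simpl in Hk1.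
destruct (pos_cases (1 - INR k * t / x)) as [[? ->]|[? ->]]; [|ring].
assert (1 <= INR k * t / x).
{ apply Rmult_le_reg_r with x; [lra|].
  replace (INR k * t / x * x) with (INR k * t) by (field; lra); nra. }
replace (1 - INR k * t / x) with 0 by lra; ring.
Qed.

(** * Integrating the kernel *)

(** Squaring removes the kink of [pos]: the first-order error is at most [d^2 h^2] everywhere, even
    where the argument changes sign. *)
Lemma derivable_pt_lim_pos_sqr c d t :
  derivable_pt_lim (fun t => pos (c + d * t) ^ 2) t (2 * d * pos (c + d * t)).
Proof.
intros eps Heps.
assert (Hdel : 0 < eps / (d ^ 2 + 1)) by (apply Rdiv_lt_0_compat; nra).
exists (mkposreal _ Hdel); intros h Hh Hlt; simpl in Hlt.
set (num := pos (c + d * (t + h)) ^ 2 - pos (c + d * t) ^ 2 - 2 * d * pos (c + d * t) * h).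
replace ((pos (c + d * (t + h)) ^ 2 - pos (c + d * t) ^ 2) / h - 2 * d * pos (c + d * t))
  with (num / h) by (unfold num; field; exact Hh).
assert (Hnum : Rabs num <= d ^ 2 * h ^ 2).
{ unfold num; apply Rabs_le.
  destruct (pos_cases (c + d * (t + h))) as [[? ->]|[? ->]],
   (pos_cases (c + d * t)) as [[? ->]|[? ->]]; nra. }
assert (Ph : 0 < Rabs h) by (apply Rabs_pos_lt; exact Hh).
unfold Rdiv; rewrite Rabs_mult, Rabs_inv.
apply Rmult_lt_reg_r with (Rabs h); [exact Ph|].
rewrite Rmult_assoc, Rinv_l, Rmult_1_r by lra.
eapply Rle_lt_trans; [exact Hnum|].
rewrite <- (pow2_abs h).
assert (Rabs h * (d ^ 2 + 1) < eps).
{ replace eps with (eps / (d ^ 2 + 1) * (d ^ 2 + 1)) by (field; nra).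
  apply Rmult_lt_compat_r; [nra|exact Hlt]. }
nra.
Qed.

Lemma derivable_pt_lim_sum1 (F f : nat -> R -> R) n t :
  (forall k, (1 <= k <= n)%nat -> derivable_pt_lim (F k) t (f k t)) ->
  derivable_pt_lim (fun t => sum1 (fun k => F k t) n) t (sum1 (fun k => f k t) n).
Proof.
induction n as [|n IH]; intros H; simpl; [apply derivable_pt_lim_const|].
apply (derivable_pt_lim_plus (fun t => sum1 (fun k => F k t) n) (F (S n)));
  [apply IH; intros; apply H; lia|apply H; lia].
Qed.

(** The termwise primitive that vanishes for [t >= x], so that minus its value at 1 is the integral
    of the kernel over [1, oo). *)
Definition kernel_primitive (n : nat) (x t : R) : R :=
  sum1 (fun k => - (sgn k * (x / 2 * / INR k)) * pos (1 + - (INR k / x) * t) ^ 2) n.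

Lemma derivable_pt_lim_kernel_primitive n x t : 0 < x ->
  derivable_pt_lim (kernel_primitive n x) t (kernel n x t).
Proof.
intros Hx; unfold kernel_primitive, kernel.
apply (derivable_pt_lim_sum1
  (fun k t => - (sgn k * (x / 2 * / INR k)) * pos (1 + - (INR k / x) * t) ^ 2)
  (fun k t => sgn k * pos (1 - INR k * t / x))).
intros k Hk; pose proof (lt_0_INR k ltac:(lia)).
replace (sgn k * pos (1 - INR k * t / x)) with
  (- (sgn k * (x / 2 * / INR k)) * (2 * - (INR k / x) * pos (1 + - (INR k / x) * t))).
- apply (derivable_pt_lim_scal (fun t => pos (1 + - (INR k / x) * t) ^ 2)).
  apply derivable_pt_lim_pos_sqr.
- replace (1 - INR k * t / x) with (1 + - (INR k / x) * t) by (field; lra).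
  field; lra.
Qed.

(** By the mean value theorem the increment of the primitive over [j, j+1] is a value of the kernel
    there, within 2/j of its value at j; the increments telescope. *)
Lemma kernel_sum_primitive n N x : 0 < x ->
  Rabs (sum1 (fun j => kernel n x (INR j)) N
        - (kernel_primitive n x (INR (S N)) - kernel_primitive n x (INR 1)))
  <= 2 * harmonic N.
Proof.
intros Hx.
rewrite <- (sum1_telescope (fun j => kernel_primitive n x (INR j))), <- sum1_minus.
unfold harmonic; rewrite <- sum1_scal; apply sum1_Rabs_le; intros j Hj.
pose proof (lt_0_INR j ltac:(lia)) as Pj.
destruct (MVT_cor2 (kernel_primitive n x) (kernel n x) (INR j) (INR (S j)))
  as (c & Ec & Hc).
{ rewrite S_INR; lra. }
{ intros; apply derivable_pt_lim_kernel_primitive; exact Hx. }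
rewrite Ec, S_INR; rewrite S_INR in Hc.
replace (INR j + 1 - INR j) with 1 by ring; rewrite Rmult_1_r.
apply kernel_variation; lra.
Qed.

Lemma kernel_primitive_vanish n x t : 0 < x -> x <= t -> kernel_primitive n x t = 0.
Proof.
intros Hx Ht; unfold kernel_primitive.
rewrite (sum1_ext _ (fun _ => 0)); [apply sum1_zero|].
intros k Hk; pose proof (le_INR 1 k ltac:(lia)) as Hk1; simpl in Hk1.
assert (1 <= INR k / x * t).
{ apply Rmult_le_reg_r with x; [lra|].
  replace (INR k / x * t * x) with (INR k * t) by (field; lra); nra. }
destruct (pos_cases (1 + - (INR k / x) * t)) as [[? ->]|[? ->]]; [|ring].
replace (1 + - (INR k / x) * t) with 0 by lra; ring.
Qed.

Lemma kernel_primitive_at_1 K x : 1 <= x -> INR K <= x < INR K + 1 ->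
  Rabs (- kernel_primitive (S K) x 1 - ln 2 / 2 * x) <= 3.
Proof.
intros Hx HK.
unfold kernel_primitive.
change (sum1 ?f (S K)) with (sum1 f K + f (S K)); cbv beta.
(* The term of index [S K] vanishes because [K + 1 > x]. *)
replace (pos (1 + - (INR (S K) / x) * 1)) with 0.
2:{ rewrite S_INR.
  assert (1 <= (INR K + 1) / x).
  { apply Rmult_le_reg_r with x; [lra|].
    replace ((INR K + 1) / x * x) with (INR K + 1) by (field; lra); lra. }
  destruct (pos_cases (1 + - ((INR K + 1) / x) * 1)) as [[? ->]|[? ->]]; lra. }
(* Expanding the square turns (x/2)(1 - k/x)^2 / k into x/(2k) - 1 + k/(2x). The first part carries
   log 2; the alternating sums of the other two stay bounded. *)
rewrite (sum1_ext _ (fun k => (- (x / 2)) * (sgn k * / INR k)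
   + (sgn k - / (2 * x) * (sgn k * INR k)))).
2:{ intros k Hk; pose proof (lt_0_INR k ltac:(lia)).
  pose proof (le_INR k K ltac:(lia)).
  replace (pos (1 + - (INR k / x) * 1)) with (1 - INR k / x); [field; lra|].
  assert (INR k / x <= 1).
  { apply Rmult_le_reg_r with x; [lra|].
    replace (INR k / x * x) with (INR k) by (field; lra); lra. }
  destruct (pos_cases (1 + - (INR k / x) * 1)) as [[? ->]|[? ->]]; lra. }
rewrite sum1_plus, sum1_minus, !sum1_scal, sum1_sgn, sum1_sgn_id.
pose proof (alternating_harmonic_ln2 K) as HA.
set (A := sum1 _ K) in *.
assert (H1 : Rabs (x / 2 * (A - ln 2)) <= 1).
{ rewrite Rabs_mult, Rabs_pos_eq by lra.
  apply Rle_trans with (x / 2 * (2 / (INR K + 1))).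
  - apply Rmult_le_compat_l; lra.
  - apply Rmult_le_reg_r with (INR K + 1); [lra|].
    replace (x / 2 * (2 / (INR K + 1)) * (INR K + 1)) with x by (field; lra); lra. }
assert (H2 : Rabs ((1 + sgn K) / 2) <= 1).
{ unfold sgn; destruct Nat.odd; apply Rabs_le; lra. }
assert (H3 : Rabs (/ (2 * x) * ((1 + sgn K * (2 * INR K + 1)) / 4)) <= 1).
{ rewrite Rabs_mult, Rabs_pos_eq by (apply Rlt_le, Rinv_0_lt_compat; lra).
  apply Rmult_le_reg_l with (2 * x); [lra|].
  rewrite <- Rmult_assoc, Rinv_r, Rmult_1_l by lra.
  pose proof (pos_INR K); unfold sgn; destruct Nat.odd; apply Rabs_le; lra. }
apply Rabs_le; 
revert H1 H2 H3; unfold Rabs; repeat destruct Rcase_abs; intros; lra.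
Qed.

(** * From the mollified average to a sum over letters *)

Definition letter (w : nat -> bool) (j : nat) : R := if w j then 1 else 0.

Lemma sum1_letter w n : sum1 (letter w) n = INR (count_b w n).
Proof.
unfold count_b; induction n as [|n IH]; [reflexivity|].
rewrite seq_S, filter_app, length_app, plus_INR, <- IH; simpl.
unfold letter at 2; destruct (w (S n)); reflexivity.
Qed.

Lemma D_w_sum1 w n :
  IZR (D_w w n) =
  sum1 (fun j => if Nat.eqb (n mod j) 0 then letter w j * sgn (n / j) else 0) n.
Proof.
rewrite <- fold_right_sum1; unfold D_w, letter, sgn.
induction (seq 1 n) as [|j l IH]; [reflexivity|]; simpl; rewrite plus_IZR, IH; f_equal.
destruct (w j), (Nat.eqb (n mod j) 0), (Nat.odd (n / j)); simpl; lra.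
Qed.

(** Writing n = j k and exchanging the sums collects the weights of all multiples of [j] into the
    kernel at [j]. *)
Lemma M_w_kernel w x (N := Z.to_nat (up x)) : 1 <= x -> x < INR N ->
  M_w w x = sum1 (fun j => letter w j * kernel N x (INR j)) N.
Proof.
intros Hx HN; unfold M_w; fold N; rewrite fold_right_sum1.
(* The positive part takes over the test [n <= x], so that summation ranges can be enlarged beyond
   [x]. *)
set (g := fun n : nat => pos (1 - INR n / x)).
assert (Hg0 : forall n, x < INR n -> g n = 0).
{ intros n Hn; unfold g.
  assert (1 < INR n / x).
  { apply Rmult_lt_reg_r with x; [lra|].
    replace (INR n / x * x) with (INR n) by (field; lra); lra. }
  destruct (pos_cases (1 - INR n / x)) as [[? ->]|[? ->]]; lra. }
rewrite (sum1_ext _ (fun n => sum1 (fun j =>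
   if Nat.eqb (n mod j) 0 then letter w j * sgn (n / j) * g n else 0) N)).
2:{ intros n Hn.
  (* Indices [j > n] do not divide [n], so the inner range can be [N] for every [n]. *)
  rewrite (sum1_truncate _ n N); [|lia|].
  2:{ intros j Hj; rewrite Nat.mod_small by lia.
      destruct (Nat.eqb_spec n 0); [lia|reflexivity]. }
  rewrite (sum1_ext _ (fun j => g n *
     (if Nat.eqb (n mod j) 0 then letter w j * sgn (n / j) else 0)))
    by (intros; destruct Nat.eqb; ring).
  rewrite sum1_scal, <- D_w_sum1.
  destruct (Rle_dec (INR n) x) as [Hle|Hnle]; [|rewrite Hg0; lra].
  f_equal; unfold g.
  assert (INR n / x <= 1).
  { apply Rmult_le_reg_r with x; [lra|].
    replace (INR n / x * x) with (INR n) by (field; lra); lra. }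
  destruct (pos_cases (1 - INR n / x)) as [[? ->]|[? ->]]; lra. }
rewrite sum1_swap; apply sum1_ext; intros j Hj.
rewrite (sum1_multiples j (fun n => letter w j * sgn (n / j) * g n)) by lia.
unfold kernel; rewrite <- sum1_scal.
(* Multiples of [j] above [N] exceed [x], where [g] vanishes; every [j] thus gets the same cut
   [N]. *)
rewrite (sum1_truncate _ (N / j) N).
- apply sum1_ext; intros k Hk; unfold g.
  rewrite Nat.mul_comm, Nat.div_mul by lia; rewrite mult_INR; ring.
- apply Nat.Div0.div_le_upper_bound; nia.
- intros k Hk.
  assert (N < k * j)%nat.
  { pose proof (Nat.div_mod_eq N j); pose proof (Nat.mod_upper_bound N j ltac:(lia)); nia. }
  rewrite <- mult_INR; change (pos (1 - INR (k * j) / x)) with (g (k * j)%nat).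
  rewrite Hg0; [ring|]. apply lt_INR in H; lra.
Qed.

(** * The logarithmic error and the final power bound *)

Lemma M_w_log_bound w beta x : 1 <= x ->
  (forall n, Rabs (INR (count_b w n) - beta * INR n) <= 1) ->
  Rabs (M_w w x - beta * ln 2 / 2 * x) <= (4 + 7 * Rabs beta) + (2 + 2 * Rabs beta) * ln x.
Proof.
intros Hx Hdisc.
destruct (archimed x) as [Hup1 Hup2].
assert (HZ : (0 < up x)%Z) by (apply lt_IZR; lra).
assert (HN : INR (Z.to_nat (up x)) = IZR (up x))
  by (rewrite INR_IZR_INZ, Z2Nat.id; [reflexivity|lia]).
rewrite M_w_kernel by lra.
set (N := Z.to_nat (up x)) in *.
rewrite <- HN in Hup1, Hup2.
destruct N as [|K]; [simpl in Hup1; lra|]. set (N := S K) in *.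
pose proof (S_INR K) as HSK; fold N in HSK.
assert (Hharm : harmonic N <= 2 + ln x).
{ eapply Rle_trans; [apply harmonic_le; unfold N; lia|].
  assert (H : ln (INR N) <= ln (2 * x)).
  { destruct (Rle_lt_or_eq_dec (INR N) (2 * x)) as [Hlt| ->]; [lra| |lra].
    apply Rlt_le, ln_increasing; lra. }
  rewrite ln_mult in H by lra.
  pose proof (ln_increment_bounds 1 ltac:(lra)) as B; rewrite ln_1 in B.
  replace (1 + 1) with 2 in B by ring; lra. }
set (f := fun j => kernel N x (INR j)).
(* The partial sums of [letter w j - beta] are at most 1 in absolute value and the kernel moves by
   at most 2/j; the boundary term vanishes as [S N > x]. *)
assert (H1 : Rabs (sum1 (fun j => (letter w j - beta) * f j) N) <= 2 * harmonic N).
{ rewrite abel_summation.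
  replace (f (S N)) with 0
    by (symmetry; apply kernel_vanish; [lra|rewrite S_INR; lra]).
  rewrite Rmult_0_r, Rplus_0_r; unfold harmonic; rewrite <- sum1_scal.
  apply sum1_Rabs_le; intros j Hj; rewrite Rabs_mult.
  replace (sum1 (fun j => letter w j - beta) j) with (INR (count_b w j) - beta * INR j).
  - rewrite <- (Rmult_1_l (2 * _)); apply Rmult_le_compat;
      [apply Rabs_pos|apply Rabs_pos|apply Hdisc|].
    apply kernel_variation; [lra|apply lt_0_INR; lia|rewrite S_INR; lra].
  - rewrite sum1_minus, sum1_letter; f_equal; clear.
    induction j as [|j IH]; [simpl; ring|]; rewrite S_INR; cbn [sum1]; lra. }
pose proof (kernel_sum_primitive N N x ltac:(lra)) as H2; fold f in H2.
rewrite kernel_primitive_vanish in H2 by (rewrite ?S_INR; lra).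
pose proof (kernel_primitive_at_1 K x Hx ltac:(lra)) as H3; fold N in H3.
change (INR 1) with 1 in H2.
set (F := sum1 f N) in *; set (T := sum1 _ N) in H1; set (p1 := kernel_primitive N x 1) in *.
replace (sum1 (fun j => letter w j * kernel N x (INR j)) N) with
  (T + beta * F).
2:{ unfold T, F; rewrite <- sum1_scal, <- sum1_plus; apply sum1_ext; intros; unfold f; ring. }
(* Three errors: discrepancy of the letters, sum against integral, integral against its main
   term. *)
replace (T + beta * F - beta * ln 2 / 2 * x) with
  (T + beta * ((F - (0 - p1)) + (- p1 - ln 2 / 2 * x))) by field.
assert (H4 : Rabs ((F - (0 - p1)) + (- p1 - ln 2 / 2 * x)) <= 2 * harmonic N + 3)
  by (eapply Rle_trans; [apply Rabs_triang|lra]).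
eapply Rle_trans; [apply Rabs_triang|]; rewrite Rabs_mult.
pose proof (Rabs_pos beta).
apply Rle_trans with (2 * (2 + ln x) + Rabs beta * (2 * (2 + ln x) + 3)); [|lra].
apply Rplus_le_compat; [lra|]; apply Rmult_le_compat_l; lra.
Qed.

Theorem theorem4p1 (w : nat -> bool) (beta : R)
  (Hw : sturmian w)
  (Hbeta : Un_cv (fun n => INR (count_b w (S n)) / INR (S n)) beta) :
  forall delta : R, 0 < delta ->
    exists C : R, forall x : R, 1 <= x ->
      Rabs (M_w w x - beta * ln 2 / 2 * x) <= C * Rpower x (1/3 + delta).
Proof.
intros delta Hdelta.
set (a := 1 / 3 + delta).
assert (Ha : 0 < a) by (unfold a; lra).
set (A := 4 + 7 * Rabs beta); set (B := 2 + 2 * Rabs beta).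
pose proof (Rabs_pos beta).
(* Since [1 + a * ln x <= x^a] with both terms nonnegative, [1 <= x^a] and [ln x <= x^a / a], which
   gives this constant. *)
exists (A + B / a); intros x Hx.
eapply Rle_trans;
  [apply (M_w_log_bound w beta x Hx (fun n => sturmian_discrepancy w beta n Hw Hbeta))|].
fold A B.
assert (Hln : 0 <= ln x).
{ destruct Hx as [Hx| <-]; [|rewrite ln_1; lra].
  rewrite <- ln_1; apply Rlt_le, ln_increasing; lra. }
assert (Hpow : 1 + a * ln x <= Rpower x a) by (unfold Rpower; apply exp_ineq1_le).
assert (HB : 0 <= B / a) by (apply Rlt_le, Rdiv_lt_0_compat; unfold B; lra).
replace (B * ln x) with (B / a * (a * ln x)) by (field; lra).
assert (0 <= a * ln x) by nra.
assert (0 <= A) by (unfold A; lra).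
nra.
Qed.
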